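(* If $n=1$ and $m\ge 2$ is even, then the equation $(-\Delta)^m u=e^u$ in $\mathbb{R}^n$ (that is, $u^{(2m)}=e^u$ on $\mathbb{R}$) admits no entire solutions.
   Context: An entire solution is a classical solution defined for all $x\in\mathbb{R}$ (no symmetry is assumed). *)

(* Defs.v *)
From Stdlib Require Import Reals.
From Coquelicot Require Import Coquelicot.
Open Scope R_scope.

(* In dimension one the Laplacian is the second derivative. *)
Definition neg_laplacian (v : R -> R) : R -> R := fun x => - Derive_n v 2 x.

(* [ex_derive_n u k x] is only meaningful together with the lower orders,
   since [Derive_n] is total; hence the quantification over all [k <= N]. *)
Definition of_class_C (N : nat) (u : R -> R) : Prop :=
  (forall (k : nat) (x : R), (k <= N)%nat -> ex_derive_n u k x) /\
  (forall x : R, continuous (Derive_n u N) x).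

(* Classical solution on the whole line of (-Delta)^m u = e^u. *)
Definition entire_solution (m : nat) (u : R -> R) : Prop :=
  of_class_C (2 * m) u /\
  forall x : R, Nat.iter m neg_laplacian u x = exp (u x).

(* Main.v *)
Require Import Defs.
From Stdlib Require Import Reals Arith.
From Coquelicot Require Import Coquelicot.
From Stdlib Require Import Lra Lia.
Open Scope R_scope.

(** Let [N = 2 * m]. Since [m] is even, the two signs cancel and the equation
    reads [u^(N) = e^u] with [N] even, so [u^(N-1)] is strictly increasing and
    takes a nonzero value somewhere. Reflecting [x] to [-x] preserves the
    equation because [N] is even, and changes the sign of the odd derivative
    [u^(N-1)]; hence [u^(N-1)] may be assumed positive at some point, and
    therefore bounded below by a positive constant to the right of it.
    Integrating down, [u, u', ..., u^(N-2)] all tend to infinity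
    ([tower_diverges]).

    Such a solution blows up in finite time. Multiplying the inequality
    [c e^u <= u^(N-j) u'^j] by [u'] gives
    [(c e^u)' <= u^(N-j) u'^(j+1) <= (u^(N-j-1) u'^(j+1))'], the omitted term of
    the product rule being nonnegative. Integrating and absorbing the constant
    into [e^u], which tends to infinity, yields the same inequality for [j + 1]
    with [c / 2] in place of [c] ([energy_inequality]). Starting from the
    equation itself ([j = 0]), one arrives at [c e^u <= u'^N]. Thus the positive
    function [e^(-u/N)] has derivative at most a negative constant on a
    half-line, which is absurd ([no_tower_with_positive_top]). *)

(** * Comparison at infinity *)

Notation eventually_at_top P := (Rbar_locally p_infty P).

Lemma eventually_and {P Q : R -> Prop} :
  eventually_at_top P -> eventually_at_top Q ->
  eventually_at_top (fun x => P x /\ Q x).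
Proof. apply filter_and. Qed.

(** The only integration used below: [f - g] is nondecreasing on a half-line. *)
Lemma eventual_comparison (f g df dg : R -> R) :
  (forall x, is_derive f x (df x)) ->
  (forall x, is_derive g x (dg x)) ->
  eventually_at_top (fun x => dg x <= df x) ->
  exists C, eventually_at_top (fun x => g x + C <= f x).
Proof.
  intros Hf Hg [a Ha].
  exists (f (a + 1) - g (a + 1)), (a + 1); intros x Hx.
  destruct (MVT_gen (fun y => f y - g y) (a + 1) x (fun y => df y - dg y))
    as [c [Hc E]].
  - intros y _; apply (is_derive_minus f g); [apply Hf | apply Hg].
  - intros y _; apply continuity_pt_filterlim.
    apply (ex_derive_continuous (fun y => f y - g y)).
    exists (df y - dg y); apply (is_derive_minus f g); [apply Hf | apply Hg].
  - rewrite Rmin_left in Hc by lra.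
    specialize (Ha c ltac:(lra)).
    assert (0 <= (df c - dg c) * (x - (a + 1))) by (apply Rmult_le_pos; lra).
    simpl in E; lra.
Qed.

Lemma diverges_of_derive_bounded_below (f df : R -> R) (a : R) :
  (forall x, is_derive f x (df x)) -> 0 < a ->
  eventually_at_top (fun x => a <= df x) ->
  forall M, eventually_at_top (fun x => M <= f x).
Proof.
  intros Hf Ha Hdf M.
  destruct (eventual_comparison f (fun x => a * x) df (fun _ => a)) as [C HC].
  - exact Hf.
  - intros x; auto_derive; [easy | ring].
  - exact Hdf.
  - assert (Hlarge : eventually_at_top (fun x => (M - C) / a < x)).
    { exists ((M - C) / a); easy. }
    generalize (eventually_and HC Hlarge); apply filter_imp; intros x [H1 H2].
    apply (Rmult_lt_compat_l a) in H2; [| easy].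
    replace (a * ((M - C) / a)) with (M - C) in H2 by (field; lra).
    lra.
Qed.

(** * Towers of derivatives *)

(** Recording the successive derivatives as a family makes reflection
    a pointwise operation. *)
Definition derivative_tower (N : nat) (d : nat -> R -> R) : Prop :=
  forall (k : nat) (x : R), (k < N)%nat -> is_derive (d k) x (d (S k) x).

Lemma tower_reflect (N : nat) (d : nat -> R -> R) :
  derivative_tower N d ->
  derivative_tower N (fun k x => (-1) ^ k * d k (- x)).
Proof.
  intros Hd k x Hk.
  apply is_derive_ext with (fun y => scal ((-1) ^ k) (d k (- y))); [easy |].
  replace ((-1) ^ S k * d (S k) (- x))
    with (scal ((-1) ^ k) (scal (-1) (d (S k) (- x))))
    by (unfold scal; simpl; unfold mult; simpl; ring).
  apply is_derive_scal.
  apply (is_derive_comp (d k) (fun y => - y)).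
  - now apply Hd.
  - auto_derive; [easy | ring].
Qed.

(** A positive lower bound on a derivative makes the function one order below
    diverge, which is again a positive lower bound. *)
Lemma tower_diverges (n : nat) (d : nat -> R -> R) (a : R) :
  derivative_tower n d -> 0 < a ->
  eventually_at_top (fun x => a <= d n x) ->
  forall k M, (k < n)%nat -> eventually_at_top (fun x => M <= d k x).
Proof.
  revert a; induction n as [| n IH]; intros a Hd Ha Htop k M Hk; [lia |].
  assert (Hn : forall M, eventually_at_top (fun x => M <= d n x)).
  { apply (diverges_of_derive_bounded_below (d n) (d (S n)) a); auto. }
  destruct (Nat.eq_dec k n) as [-> | Hne]; [apply Hn |].
  apply (IH 1); [| lra | apply Hn | lia].
  intros i x Hi; apply Hd; lia.
Qed.

Lemma tower_top_increasing (N : nat) (d : nat -> R -> R) :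
  (1 <= N)%nat ->
  derivative_tower N d ->
  (forall x, d N x = exp (d 0%nat x)) ->
  forall x y, x < y -> d (N - 1)%nat x < d (N - 1)%nat y.
Proof.
  intros HN Hd Heq x y Hxy.
  apply (incr_function (d (N - 1)%nat) m_infty p_infty (d N)); try easy.
  - intros z _ _; replace N with (S (N - 1)) at 2 by lia; apply Hd; lia.
  - intros z _ _; rewrite Heq; apply exp_pos.
Qed.

(** * Finite-time blow-up *)

(** Each step multiplies by [u'] and integrates, trading one order of
    differentiation for one more power of [u']. Divergence of [d 0] is what
    allows integration constants to be absorbed by [exp]. *)
Lemma energy_inequality (N : nat) (d : nat -> R -> R) :
  derivative_tower N d ->
  (forall x, d N x = exp (d 0%nat x)) ->
  (forall M, eventually_at_top (fun x => M <= d 0%nat x)) ->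
  (forall k, (0 < k < N)%nat -> eventually_at_top (fun x => 0 <= d k x)) ->
  forall j, (j < N)%nat ->
  exists c, 0 < c /\
    eventually_at_top (fun x => c * exp (d 0%nat x) <= d (N - j)%nat x * d 1%nat x ^ j).
Proof.
  intros Hd Heq Hdiv Hpos j; induction j as [| j IH]; intros Hj.
  - exists 1; split; [lra |].
    exists 0; intros x _; rewrite Nat.sub_0_r, Heq; simpl; lra.
  - destruct IH as [c [Hc Hineq]]; [lia |].
    set (k := (N - S j)%nat).
    assert (Hk : (N - j)%nat = S k) by (unfold k; lia).
    rewrite Hk in Hineq.
    destruct (eventual_comparison
      (fun x => d k x * d 1%nat x ^ S j)
      (fun x => c * exp (d 0%nat x))
      (fun x => d (S k) x * d 1%nat x ^ S j
                + d k x * (INR (S j) * d 2%nat x * d 1%nat x ^ j))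
      (fun x => c * (d 1%nat x * exp (d 0%nat x)))) as [C HC].
    + intros x.
      apply (is_derive_mult (d k) (fun y => d 1%nat y ^ S j)).
      * apply Hd; unfold k; lia.
      * apply (is_derive_pow (d 1%nat) (S j)); apply Hd; lia.
      * intros; apply Rmult_comm.
    + intros x.
      apply is_derive_scal.
      apply (is_derive_comp exp (d 0%nat)); [apply is_derive_exp | apply Hd; lia].
    + assert (H2 : eventually_at_top (fun x => 0 <= d 2%nat x)).
      { (* [d 2] is the top of the tower when [N = 2] *)
        destruct (Nat.eq_dec 2 N) as [E | E]; [| apply Hpos; lia].
        exists 0; intros x _; rewrite E, Heq; left; apply exp_pos. }
      generalize (eventually_and Hineq (eventually_and H2 (eventually_and
        (Hpos 1%nat ltac:(lia)) (Hpos k ltac:(unfold k; lia))))).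
      apply filter_imp; intros x [Hx [P2 [P1 Pk]]].
      assert (A : 0 <= d k x * (INR (S j) * d 2%nat x * d 1%nat x ^ j)).
      { repeat apply Rmult_le_pos; auto using pos_INR, pow_le. }
      apply (Rmult_le_compat_l _ _ _ P1) in Hx.
      simpl pow; lra.
    + exists (c / 2); split; [lra |].
      (* [e^u >= 1 + u], so [- C <= c / 2 * e^u] once [u >= - 2 * C / c] *)
      generalize (eventually_and HC (Hdiv (- 2 * C / c))).
      apply filter_imp; intros x [Hx Hu].
      assert (He : 1 + d 0%nat x <= exp (d 0%nat x)) by apply exp_ineq1_le.
      assert (HC2 : c / 2 * (- 2 * C / c) <= c / 2 * exp (d 0%nat x)).
      { apply Rmult_le_compat_l; lra. }
      replace (c / 2 * (- 2 * C / c)) with (- C) in HC2 by (field; lra).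
      lra.
Qed.

Lemma pow_exp (x : R) (n : nat) : exp x ^ n = exp (INR n * x).
Proof.
  induction n as [| n IH].
  - simpl; rewrite Rmult_0_l; symmetry; apply exp_0.
  - rewrite S_INR; simpl pow; rewrite IH, <- exp_plus; f_equal; ring.
Qed.

Lemma no_tower_with_positive_top (N : nat) (d : nat -> R -> R) (x0 : R) :
  (2 <= N)%nat ->
  derivative_tower N d ->
  (forall x, d N x = exp (d 0%nat x)) ->
  0 < d (N - 1)%nat x0 -> False.
Proof.
  intros HN Hd Heq Hx0.
  assert (HN1 : (1 <= N)%nat) by lia.
  assert (Htop : eventually_at_top (fun x => d (N - 1)%nat x0 <= d (N - 1)%nat x)).
  { exists x0; intros x Hx.
    left; now apply (tower_top_increasing N). }
  assert (Hdiv : forall k M, (k < N - 1)%nat -> eventually_at_top (fun x => M <= d k x)).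
  { apply (tower_diverges (N - 1) d (d (N - 1)%nat x0)); [| easy | easy].
    intros k x Hk; apply Hd; lia. }
  assert (Hpos : forall k, (0 < k < N)%nat -> eventually_at_top (fun x => 0 <= d k x)).
  { intros k Hk; destruct (Nat.eq_dec k (N - 1)) as [-> | E]; [| apply Hdiv; lia].
    revert Htop; apply filter_imp; intros; lra. }
  destruct (energy_inequality N d Hd Heq (fun M => Hdiv 0%nat M ltac:(lia)) Hpos
              (N - 1) ltac:(lia)) as [c [Hc Hineq]].
  set (w := fun x => exp (- d 0%nat x / INR N)).
  assert (HNpos : 0 < INR N) by (apply lt_0_INR; lia).
  (* [b <= 1] gives [b ^ N <= b < c], which bounds the [N]-th root of [c] from
     below without introducing real powers *)
  set (b := Rmin 1 c / 2).
  assert (Hmin : 0 < Rmin 1 c) by (apply Rmin_pos; lra).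
  assert (Hb : 0 < b <= 1).
  { assert (H := Rmin_l 1 c); unfold b; lra. }
  assert (HbN : b ^ N < c).
  { apply Rle_lt_trans with b; [| assert (H := Rmin_r 1 c); unfold b; lra].
    replace N with (S (N - 1)) by lia; simpl.
    rewrite <- (Rmult_1_r b) at 3; apply Rmult_le_compat_l; [lra |].
    rewrite <- (pow1 (N - 1)); apply pow_incr; lra. }
  assert (Hwpow : forall x, w x ^ N * exp (d 0%nat x) = 1).
  { intros x; unfold w.
    rewrite pow_exp, <- exp_plus, <- exp_0; f_equal; field; lra. }
  assert (Hslope : eventually_at_top (fun x => b <= d 1%nat x * w x)).
  { generalize (eventually_and Hineq (Hpos 1%nat ltac:(lia))).
    apply filter_imp; intros x [Hx P1].
    replace (N - (N - 1))%nat with 1%nat in Hx by lia.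
    replace (d 1%nat x * d 1%nat x ^ (N - 1)) with (d 1%nat x ^ N) in Hx
      by (replace N with (S (N - 1)) at 1 by lia; easy).
    assert (Hw : 0 < w x) by apply exp_pos.
    assert (Hprod : c <= (d 1%nat x * w x) ^ N).
    { rewrite Rpow_mult_distr.
      apply (Rmult_le_compat_r (w x ^ N)) in Hx; [| left; now apply pow_lt].
      rewrite Rmult_assoc, (Rmult_comm (exp _)), Hwpow in Hx; lra. }
    destruct (Rle_lt_dec b (d 1%nat x * w x)) as [| Hlt]; [easy | exfalso].
    assert ((d 1%nat x * w x) ^ N <= b ^ N); [| lra].
    apply pow_incr; split; [apply Rmult_le_pos |]; lra. }
  assert (Hw' : eventually_at_top (fun x => 1 <= - w x)).
  { apply (diverges_of_derive_bounded_below
             (fun x => - w x) (fun x => d 1%nat x * w x / INR N) (b / INR N)).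
    - intros x; unfold w.
      assert (Hd0 := Hd 0%nat x ltac:(lia)).
      auto_derive.
      + now exists (d 1%nat x).
      + rewrite (is_derive_unique (fun y : R => d 0%nat y) x _ Hd0); unfold Rdiv; ring.
    - now apply Rdiv_lt_0_compat.
    - revert Hslope; apply filter_imp; intros x Hx.
      apply Rmult_le_compat_r; [left; now apply Rinv_0_lt_compat | easy]. }
  destruct Hw' as [y Hy].
  specialize (Hy (y + 1) ltac:(lra)).
  assert (0 < w (y + 1)) by apply exp_pos.
  lra.
Qed.

(** If [d (N - 1)] vanishes at [0], strict monotonicity makes it positive at
    [1]; if it is negative there, reflection makes it positive. *)
Lemma no_exponential_tower (N : nat) (d : nat -> R -> R) :
  (2 <= N)%nat -> Nat.Even N ->
  derivative_tower N d ->
  (forall x, d N x = exp (d 0%nat x)) -> False.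
Proof.
  intros HN [p Hp] Hd Heq.
  destruct (Rtotal_order (d (N - 1)%nat 0) 0) as [Hneg | [Hzero | Hpos]].
  - apply (no_tower_with_positive_top N (fun k x => (-1) ^ k * d k (- x)) 0 HN).
    + now apply tower_reflect.
    + intros x; rewrite Heq, Hp, pow_1_even; simpl; now rewrite !Rmult_1_l.
    + replace (N - 1)%nat with (S (2 * (p - 1))) in * by lia.
      rewrite pow_1_odd, Ropp_0; lra.
  - apply (no_tower_with_positive_top N d 1 HN Hd Heq).
    rewrite <- Hzero.
    apply (tower_top_increasing N); auto; [lia | lra].
  - exact (no_tower_with_positive_top N d 0 HN Hd Heq Hpos).
Qed.

(** * The iterated Laplacian *)

Lemma iter_neg_laplacian (m : nat) (u : R -> R) (x : R) :
  Nat.iter m neg_laplacian u x = (-1) ^ m * Derive_n u (2 * m) x.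
Proof.
  revert x; induction m as [| m IH]; intros x.
  - simpl; ring.
  - change (Nat.iter (S m) neg_laplacian u x)
      with (- Derive_n (Nat.iter m neg_laplacian u) 2 x).
    rewrite (Derive_n_ext _ _ 2 x IH), Derive_n_scal_l, Derive_n_comp.
    replace (2 + 2 * m)%nat with (2 * S m)%nat by lia.
    simpl pow; ring.
Qed.

Theorem theorem2p3 : forall m : nat, (2 <= m)%nat -> Nat.Even m ->
  ~ (exists u : R -> R, entire_solution m u).
Proof.
  intros m Hm [p Hp] [u [[Hex _] Heq]].
  apply (no_exponential_tower (2 * m) (Derive_n u)).
  - lia.
  - now exists m.
  - intros k x Hk; apply Derive_correct.
    apply (Hex (S k) x); lia.
  - intros x; simpl (Derive_n u 0 x).
    rewrite <- Heq, iter_neg_laplacian, Hp, pow_1_even; ring.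
Qed.
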